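(* Let $L$ be a zero-dimensional compact space which is a continuous image of a zero-dimensional compact line $L^*$ (a linearly ordered set that is compact in its order topology). Then $L$ is a Boolean image of a compact connected space.
   Context: All compact spaces are Hausdorff and nonempty; ''zero-dimensional'' means having a base of clopen sets. A pseudoclopen of a compact space $K$ is a pair $a=(a^-,a^+)$ with $a^-\subset K$ closed, $a^+\subset K$ open and $a^-\subset a^+$. Let $\mathcal{G}$ be a family of subsets of a nonempty set $X$. A bijection $\phi$ from $\mathcal{G}$ onto a family of pseudoclopens of $K$ is an isomorphism if for all $n,m\ge 0$ and all distinct $a_1,\ldots,a_n,b_1,\ldots,b_m\in\mathcal{G}$: (1) if $\bigcap_{i\le n}a_i\setminus\bigcup_{j\le m}b_j=\emptyset$ then $\bigcap_{i\le n}\phi(a_i)^+\setminus\bigcup_{j\le m}\phi(b_j)^-=\emptyset$; (2) if $\bigcap_{i\le n}\phi(a_i)^-\setminus\bigcup_{j\le m}\phi(b_j)^+=\emptyset$ then $\bigcap_{i\le n}a_i\setminus\bigcup_{j\le m}b_j=\emptyset$. (Empty intersections are $X$, respectively $K$.) A zero-dimensional compact space $L$ is a Boolean image of a compact space $K$ if there is a family $\mathcal{G}$ of clopen subsets of $L$ (regarded as subsets of $X=L$) which separates the points of $L$ (for all $x\neq y$ in $L$ there is $a\in\mathcal{G}$ with $|a\cap\{x,y\}|=1$) and which is isomorphic to a family of pseudoclopens of $K$. *)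

(* Defs.v *)
From mathcomp Require Import all_boot all_order all_algebra.
From mathcomp Require Import all_classical topology.

Set Implicit Arguments.
Unset Strict Implicit.
Unset Printing Implicit Defensive.

Local Open Scope classical_set_scope.

Definition compact_space (T : topologicalType) : Prop :=
  [/\ [set: T] !=set0, hausdorff_space T & compact [set: T]].

(* The library's [zero_dimensional] only asks that distinct points be separated
   by a clopen set; here the clopen sets must form a base. *)
Definition clopen_base (T : topologicalType) : Prop := basis (@clopen T).

Definition continuous_image (S T : topologicalType) : Prop :=
  exists2 f : S -> T, continuous f & set_surj [set: S] [set: T] f.

(* a.1 is a^- and a.2 is a^+. *)
Definition pseudoclopen (K : topologicalType) (a : set K * set K) : Prop :=
  [/\ closed a.1, open a.2 & a.1 `<=` a.2].

Definition pseudoclopen_iso (X : Type) (K : topologicalType)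
    (G : set (set X)) (P : set (set K * set K))
    (phi : set X -> set K * set K) : Prop :=
  [/\ P `<=` @pseudoclopen K,
      set_bij G P phi &
      forall s t : seq (set X),
        [set` s] `<=` G -> [set` t] `<=` G -> uniq (s ++ t) ->
        ((\bigcap_(a in [set` s]) a) `\` (\bigcup_(b in [set` t]) b) = set0 ->
         (\bigcap_(a in [set` s]) (phi a).2) `\`
           (\bigcup_(b in [set` t]) (phi b).1) = set0) /\
        ((\bigcap_(a in [set` s]) (phi a).1) `\`
           (\bigcup_(b in [set` t]) (phi b).2) = set0 ->
         (\bigcap_(a in [set` s]) a) `\` (\bigcup_(b in [set` t]) b) = set0)].

Definition separates_points (X : Type) (G : set (set X)) : Prop :=
  forall x y : X, x <> y -> exists2 a, G a & (a `&` [set x; y] #= `I_1)%card.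

Definition boolean_image (L K : topologicalType) : Prop :=
  exists (G : set (set L)) (P : set (set K * set K))
         (phi : set L -> set K * set K),
    [/\ G `<=` @clopen L, separates_points G & pseudoclopen_iso G P phi].

(* Main.v *)
Require Import Defs.
From mathcomp Require Import all_boot all_order all_algebra.
From mathcomp Require Import all_classical wochoice reals.
From mathcomp Require Import topology function_spaces normedtype Rstruct.

(** A clopen set of a compact line is determined, up to complement, by the
    finite set of its jumps, i.e. of the points [p] that have an immediate
    successor lying on the other side; jumps are submodular. Pulling back along
    the surjection, every clopen set of [L] becomes a cut whose cost is the
    finite set of its jumps. Finite sets of points are compared
    colexicographically with respect to a well-ordering, so minimal cuts between
    two points exist, are unique up to complement, and can be uncrossed as in a
    Gomory-Hu tree. The minimal cuts that avoid a base point form a laminar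
    family [G] which separates points and in which no member is a finite union
    of smaller ones.

    The compact connected space consists of the weightings [k : G -> [0, 1]]
    such that [k a = 0] or [k b = 1] whenever [a] is strictly below [b], and
    [k a = 0] or [k b = 0] whenever [a] and [b] are disjoint; the pseudoclopen
    of [a] is the pair [({k | k a = 1}, {k | k a <> 0})]. The weightings are
    connected because a clopen set of them depends on finitely many coordinates:
    one may lower the coordinates in that finite set to [0] one after the other,
    starting from the innermost, resetting after each step the remaining
    coordinates to the least values allowed. *)

Set Implicit Arguments.
Unset Strict Implicit.
Unset Printing Implicit Defensive.
Import Order.TTheory GRing.Theory Num.Theory numFieldNormedType.Exports.

Local Open Scope classical_set_scope.
Local Open Scope ring_scope.

(** * Jumps of clopen sets in a compact line *)

Section LargeFiniteSets.
Context {T : Type}.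

(** The filter of all sufficiently large finite sets. It turns compactness, in near-covering form,
    into one finite set, and later indexes a limit. *)
Definition largeFin : set_system (set T) :=
  filter_from finite_set (fun S0 => [set S | finite_set S /\ S0 `<=` S]).

Global Instance largeFin_filter : ProperFilter largeFin.
Proof.
apply: filter_from_proper; last by move=> S finS; exists S; split.
apply: filter_from_filter; first by exists set0.
move=> A B finA finB; exists (A `|` B); first by rewrite finite_setU.
by move=> S [finS]; rewrite subUset => -[AS BS]; do !split.
Qed.

Lemma largeFinW S0 : finite_set S0 -> largeFin [set S | S0 `<=` S].
Proof. by move=> fin0; exists S0 => // S []. Qed.

Lemma largeFin_ex (P : set T -> Prop) :
  (\forall S \near largeFin, P S) -> exists2 S, finite_set S & P S.
Proof. by move=> [S finS SP]; exists S => //; apply: SP; split. Qed.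

End LargeFiniteSets.

Section CompactLine.
Context {d : Order.disp_t} {T : orderTopologicalType d}.
Implicit Types (C D E : set T) (x y z p q : T).

(** A cluster point of the filter of tails of [C] is the maximum: for a larger [c] in [C], []-oo,
    c[] would be a neighbourhood missing the tail of [c]. *)
Lemma compact_has_max C : compact C -> C !=set0 ->
  exists2 m, C m & forall x, C x -> (x <= m)%O.
Proof.
move=> Cc [c0 Cc0].
pose F := filter_from C (fun c => C `&` [set x | (c <= x)%O]).
have FF : ProperFilter F.
  apply: filter_from_proper; last by move=> c Cx; exists c; split => /=.
  apply: filter_from_filter; first by exists c0.
  move=> c e Cx Ce; have [ce|ec] := leP c e.
    by exists e => // x [Dx /= ex]; do !split => //=; exact: le_trans ex.
  by exists c => // x [Dx /= ex]; do !split => //=; apply: le_trans ex; exact: ltW.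
have FC : F C by exists c0 => // x [].
have [m [Cm clm]] := Cc F FF FC.
exists m => // c Cx; rewrite leNgt; apply/negP => mc.
have nm : nbhs m `]-oo, c[%classic.
  by apply: open_nbhs_nbhs; split; [exact: lray_open|rewrite /= in_itv].
have [x [[_ /= cx]]] : (C `&` [set x | (c <= x)%O]) `&` `]-oo, c[%classic !=set0.
  by apply: clm => //; exists c.
by rewrite in_itv /= ltNge cx.
Qed.

Lemma compact_has_min C : compact C -> C !=set0 ->
  exists2 m, C m & forall x, C x -> (m <= x)%O.
Proof.
move=> Cc [c0 Cc0].
pose F := filter_from C (fun c => C `&` [set x | (x <= c)%O]).
have FF : ProperFilter F.
  apply: filter_from_proper; last by move=> c Cx; exists c; split => /=.
  apply: filter_from_filter; first by exists c0.
  move=> c e Cx Ce; have [ce|ec] := leP c e.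
    by exists c => // x [Dx /= xc]; do !split => //=; exact: le_trans ce.
  by exists e => // x [Dx /= xe]; do !split => //=; apply: le_trans xe _; exact: ltW.
have FC : F C by exists c0 => // x [].
have [m [Cm clm]] := Cc F FF FC.
exists m => // c Cx; rewrite leNgt; apply/negP => mc.
have nm : nbhs m `]c, +oo[%classic.
  by apply: open_nbhs_nbhs; split; [exact: rray_open|rewrite /= in_itv /= andbT].
have [x [[_ /= cx]]] : (C `&` [set x | (x <= c)%O]) `&` `]c, +oo[%classic !=set0.
  by apply: clm => //; exists c.
by rewrite in_itv /= andbT ltNge cx.
Qed.

Definition covers p q := (p < q)%O /\ forall z, ~ (p < z < q)%O.

Lemma covers_uniq p q q' : covers p q -> covers p q' -> q = q'.
Proof.
move=> [pq npq] [pq' npq']; case: (ltgtP q q') => // h.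
- by case: (npq' q); rewrite pq.
- by case: (npq q'); rewrite pq'.
Qed.

Definition jumps D : set T := [set p | exists2 q, covers p q & ~ (D p <-> D q)].

Lemma jumpsP D p q : covers p q -> jumps D p <-> ~ (D p <-> D q).
Proof.
move=> pq; split; last by exists q.
by case=> q' pq'; rewrite (covers_uniq pq pq').
Qed.

(** [D] is constant on an interval around each point; a jump in that interval must be its greatest
    element, since otherwise the successor lies in it too. Compactness leaves finitely many. *)
Lemma clopen_finite_jumps D : compact [set: T] -> clopen D -> finite_set (jumps D).
Proof.
move=> cT [oD cD].
have loc z : exists i : interval T,
    [/\ open [set` i], z \in i & forall x, x \in i -> D x <-> D z].
  have : nbhs z [set x | D x <-> D z].
    have [Dz|nDz] := pselect (D z).
      apply: filterS (open_nbhs_nbhs (conj oD Dz)) => x Dx; split => //.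
    by apply: filterS (open_nbhs_nbhs (conj (closed_openC cD) nDz)) => x Dx; split.
  rewrite itv_nbhsE => -[i [oi zi] iD]; exists i; split => //.
  exact: itv_open_ends_open.
suff : \forall S \near largeFin, [set: T] `<=` (fun x => jumps D x -> S x).
  by move=> /largeFin_ex [S finS JS]; apply: sub_finite_set finS => x; exact: JS.
move/compact_near_coveringP : cT; apply => z _.
have [i [oi zi iD]] := loc z.
pose M := [set p | p \in i /\ forall x, x \in i -> (x <= p)%O].
have finM : finite_set M.
  have [[m [mi mM]]|nM] := pselect (M !=set0).
    apply: sub_finite_set (finite_set1 m) => p [pi pM] /=.
    by apply/eqP; rewrite eq_le mM // pM.
  by apply: sub_finite_set (finite_set0 T) => p Mp; case: nM; exists p.
exists ([set` i], [set S | M `<=` S]) => /=.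
  by split; [exact: open_nbhs_nbhs|exact: largeFinW].
move=> -[p S] /= [pz MS] [q [pq npq] nD]; apply: MS; split => // x xz.
rewrite leNgt; apply/negP => px; apply: nD.
have qx : (q <= x)%O by rewrite leNgt; apply/negP => xq; case: (npq x); rewrite px.
have qz : q \in i.
  move: pz xz; case: (i) => l r; rewrite !itv_boundlr => /andP[ip _] /andP[_ xi].
  by rewrite (le_trans ip) /= ?(le_trans _ xi) ?bnd_simp ?(ltW pq).
by rewrite (iD _ pz) (iD _ qz).
Qed.

Lemma clopen_jumps0 D : compact [set: T] -> clopen D -> jumps D = set0 ->
  forall p q, D p -> D q.
Proof.
(* If [p] is in [E] and a larger [q] is not, the last point [m] of [E] up to [q] and the first point
   [n] outside [E] after [m] form a jump. The downward case is this one for the complement. *)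
have key (E : set T) : compact [set: T] -> clopen E -> jumps E = set0 ->
    forall p q, (p < q)%O -> E p -> E q.
  move=> cT [oE cE] j0 p q pq Ep; apply: contrapT => nEq.
  have [m [Em mq] mM] : exists2 m, (E `&` `]-oo, q]%classic) m &
      forall x, (E `&` `]-oo, q]%classic) x -> (x <= m)%O.
    apply: compact_has_max; last by exists p; split => //; rewrite /= in_itv /= ltW.
    by apply: subclosed_compact cT _ => //; apply: closedI => //; exact: lray_closed.
  have [n [En mn] nM] : exists2 n, (~` E `&` `[m, +oo[%classic) n &
      forall x, (~` E `&` `[m, +oo[%classic) x -> (n <= x)%O.
    apply: compact_has_min; last first.
      by exists q; split => //; move: mq; rewrite /= !in_itv /= andbT.
    apply: subclosed_compact cT _ => //; apply: closedI; last exact: rray_closed.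
    exact: open_closedC.
  move: mq mn; rewrite /= !in_itv /= andbT => mq mn.
  have mltn : (m < n)%O by rewrite lt_neqAle mn andbT; apply/eqP => e; apply: En; rewrite -e.
  have nq : (n <= q)%O by apply: nM; split => //; rewrite /= in_itv /= mq.
  suff : jumps E m by rewrite j0.
  exists n; last by case=> /(_ Em).

  split => // z /andP[mz zn].
  have [Ez|nEz] := pselect (E z).
    suff : (z <= m)%O by rewrite leNgt mz.
    apply: mM; split => //.
    by rewrite /= in_itv /= (le_trans (ltW zn)).
  suff : (n <= z)%O by rewrite leNgt zn.
  apply: nM; split => //.
  by rewrite /= in_itv /= (ltW mz).
move=> cT Dc j0 p q Dp; have [//|qp|<-//] := ltgtP p q; first by move=> /key; apply.
apply: contrapT => nDq; suff : (~` D) p by [].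
apply: (key _ cT (clopenC set0 Dc) _ q p) => //; rewrite -j0.
by apply/seteqP; split => r [s rs /= h]; exists s => //=; tauto.
Qed.

End CompactLine.

Lemma jumpsC (d : Order.disp_t) (T : orderTopologicalType d) (D : set T) :
  jumps (~` D) = jumps D.
Proof.
apply/seteqP; split => p [q pq /= h]; exists q => //= h'; apply: h; move: h'; rewrite /setC /=;
  by have [?|?] := pselect (D p); have [?|?] := pselect (D q); tauto.
Qed.

(** With the next lemma, submodularity in pointwise form: the jump indicators of the intersection
    and of the union add up to at most those of [D] and [E]. *)
Lemma jumpsIU_subU (d : Order.disp_t) (T : orderTopologicalType d) (D E : set T) :
  jumps (D `&` E) `|` jumps (D `|` E) `<=` jumps D `|` jumps E.
Proof.
move=> p [] [q pq h]; have [Dpq|nDpq] := pselect (D p <-> D q);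
  (try by left; exists q); right; exists q => // Epq; apply: h;
  by rewrite /setI /setU /=; tauto.
Qed.

Lemma jumpsIU_subI (d : Order.disp_t) (T : orderTopologicalType d) (D E : set T) :
  jumps (D `&` E) `&` jumps (D `|` E) `<=` jumps D `&` jumps E.
Proof.
move=> p [[q pq h]] /(jumpsP _ pq) h'; split; apply/(jumpsP _ pq) => k; move: h h';
  rewrite /setI /setU /=; have [?|?] := pselect (D p); have [?|?] := pselect (E p); tauto.
Qed.

(** The set [S] where [D] and [E] agree is clopen without jumps, hence empty or everything. *)
Lemma clopen_jumps_inj (d : Order.disp_t) (T : orderTopologicalType d) (D E : set T) :
  compact [set: T] -> clopen D -> clopen E -> jumps D = jumps E ->
  D = E \/ D = ~` E.
Proof.
move=> cT cD cE DE; pose S := (D `&` E) `|` (~` D `&` ~` E).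
have cS : clopen S.
  by apply: clopenU; apply: clopenI => //; exact: (clopenC set0).
have S0 : jumps S = set0.
  rewrite -subset0 => p [q pq]; apply.
  have : jumps D p <-> jumps E p by rewrite DE.
  rewrite !(jumpsP _ pq) /S /setU /setI /setC /=.
  by have [?|?] := pselect (D p); have [?|?] := pselect (D q);
    have [?|?] := pselect (E p); have [?|?] := pselect (E q); tauto.
have [[p Sp]|nS] := pselect (S !=set0).
  left; apply/seteqP; split => q Dq.
    have : S q by exact: clopen_jumps0 Sp.
    by case=> -[].
  have : S q by exact: clopen_jumps0 Sp.
  by case=> -[].
right; apply/seteqP; split => q Dq.
  by move=> Eq; apply: nS; exists q; left.
by apply: contrapT => nDq; apply: nS; exists q; right.
Qed.

(** * Colexicographic order on finite sets *)

Section Colex.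
Context {T : eqType} {R : rel T}.
Hypothesis R_wo : well_order R.
Implicit Types (A B C : set T) (F : set (set T)).

Lemma wo_set_min A : A !=set0 -> exists2 m, A m & forall x, A x -> R m x.
Proof.
move=> [a Aa]; have [|m [[Am Amin] _]] := R_wo (A := [pred x | `[< A x >]]).
  by exists a; exact/asboolP.
by exists m; [exact/asboolP|move=> x /asboolP; exact: Amin].
Qed.

Lemma wo_total x y : R x y \/ R y x.
Proof.
have [|m [->|->] mm] := @wo_set_min [set x; y]; first by exists x; left.
  by left; apply: mm; right.
by right; apply: mm; left.
Qed.

(** Least elements are unique in a [well_order], and both points are least in the pair. *)
Lemma wo_anti x y : R x y -> R y x -> x = y.
Proof.
move=> xy yx; have refl z : R z z by case: (wo_total z z).
have [|m [_ um]] := R_wo (A := pred2 x y); first by exists x; rewrite !inE eqxx.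
have -> : x = m.
  by apply/esym/um; split; [rewrite !inE eqxx|move=> z; rewrite !inE => /orP[]/eqP->].
by apply: um; split; [rewrite !inE eqxx orbT|move=> z; rewrite !inE => /orP[]/eqP->].
Qed.

Lemma wo_trans x y z : R x y -> R y z -> R x z.
Proof.
move=> xy yz; have [|m mm mmin] := @wo_set_min [set t | [\/ t = x, t = y | t = z]].
  by exists x; constructor 1.
have mx : R m x by apply: mmin; constructor 1.
have my : R m y by apply: mmin; constructor 2.
have mz : R m z by apply: mmin; constructor 3.
case: mm mx my mz => -> // h1 h2 h3; first by rewrite (wo_anti xy h1).
by rewrite -(wo_anti yz h2).
Qed.

Lemma finite_set_max A : finite_set A -> A !=set0 ->
  exists2 m, A m & forall x, A x -> R x m.
Proof.
move=> /finite_seqP[s ->] {A}; elim: s => [[x]//|a s ih] _.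
have [[b bs]|s0] := pselect ([set` s] !=set0); last first.
  exists a => [|x]; first by rewrite /= inE eqxx.
  rewrite /= inE => /orP[/eqP->|xs]; first by case: (wo_total a a).
  by case: s0; exists x.
have [m ms mmax] := ih (ex_intro _ b bs).
have [am|ma] := wo_total a m.
  exists m => [|x]; first by rewrite /= inE ms orbT.
  by rewrite /= inE => /orP[/eqP->//|]; exact: mmax.
exists a => [|x]; first by rewrite /= inE eqxx.
rewrite /= inE => /orP[/eqP->|xs]; first by case: (wo_total a a).
by apply: wo_trans ma; exact: mmax.
Qed.

(* On finite sets this compares the formal sums [\sum_(p in A) 2 ^ p]. *)
Definition colex A B :=
  exists p, [/\ B p, ~ A p & forall q, R p q -> q <> p -> A q <-> B q].

(** The greatest element of the symmetric difference decides. *)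
Lemma colex_total A B : finite_set A -> finite_set B ->
  [\/ A = B, colex A B | colex B A].
Proof.
move=> finA finB; have [AB|nAB] := pselect (A = B); first by constructor 1.
have [||m Dm mmax] := @finite_set_max [set x | ~ (A x <-> B x)].
- apply: (@sub_finite_set _ _ (A `|` B)); last by rewrite finite_setU.
  by move=> x /= h; apply: contrapT => /not_orP[nA nB]; apply: h; split.
- apply: contrapT => h; apply: nAB; apply/seteqP; split => x Ax;
    apply: contrapT => nBx; apply: h; exists x => -[h1 h2]; apply: nBx; tauto.
have eqm q : R m q -> q <> m -> A q <-> B q.
  move=> mq qm; apply: contrapT => nq; apply: qm.
  by apply: wo_anti mq; exact: mmax.
have [Bm|nBm] := pselect (B m).
  by constructor 2; exists m; split => // Am; apply: Dm; split.
constructor 3; exists m; split => //; first by apply: contrapT => nAm; apply: Dm; split.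
by move=> q mq qm; apply: iff_sym; exact: eqm.
Qed.

(* The hypotheses say that the indicators satisfy [S1 + S2 <= A + B]. *)
Lemma colex_submodular A B S1 S2 :
  S1 `|` S2 `<=` A `|` B -> S1 `&` S2 `<=` A `&` B ->
  colex A S1 -> colex B S2 -> False.
Proof.
move=> US IS [p [S1p nAp eqp]] [q [S2q nBq eqq]].
have [pq|qp] := wo_total p q.
  have [e|qp] := pselect (q = p).
    by subst q; case: (IS p (conj S1p S2q)).
  have [Aq|//] := US q (or_intror S2q).
  by case: nBq; apply: (IS q _).2; split => //; exact/eqp.
have [e|pq] := pselect (p = q).
  by subst q; case: (IS p (conj S1p S2q)).
have [//|Bp] := US p (or_introl S1p).
by case: nAp; apply: (IS p _).1; split => //; exact/eqq.
Qed.

Lemma colex_trans A B C : colex A B -> colex B C -> colex A C.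
Proof.
move=> [p [Bp nAp eqp]] [q [Cq nBq eqq]].
have npq : p <> q by move=> e; apply: nBq; rewrite -e.
have [pq|qp] := wo_total p q.
  exists q; split => // [Aq|r qr rq]; first by apply/nBq/eqp => // e; exact: npq.
  rewrite (eqp r (wo_trans pq qr)) ?eqq // => e; subst r.
  by apply: npq; exact: wo_anti.
exists p; split => // [|r pr rp]; first exact/eqq.
rewrite eqp ?eqq //; first exact: wo_trans qp pr.
by move=> e; subst r; apply: npq; exact: wo_anti.
Qed.

Lemma colex_irr A : ~ colex A A.
Proof. by case=> p []. Qed.

(** The least possible maximum is fixed first, then the part below it is minimised, by well-founded
    induction on a strict upper bound. *)
Lemma colex_min F : (forall A, F A -> finite_set A) -> F !=set0 ->
  exists2 A, F A & forall B, F B -> A = B \/ colex A B.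
Proof.
have step F' : (forall A, F' A -> finite_set A) -> F' !=set0 ->
    (forall p F'', (forall A, F'' A -> finite_set A /\
        forall x, A x -> R x p /\ x <> p) ->
      (exists2 A, F' A & A p /\ forall x, A x -> R x p) -> F'' !=set0 ->
      exists2 A, F'' A & forall B, F'' B -> A = B \/ colex A B) ->
    exists2 A, F' A & forall B, F' B -> A = B \/ colex A B.
  move=> finF [A0 FA0] rec.
  have [F0|nF0] := pselect (F' set0).
    exists set0 => // B FB; have [B0|nB0] := pselect (B !=set0); last first.
      by left; apply/esym; rewrite -subset0 => x Bx; case: nB0; exists x.
    right; have [m Bm mmax] := finite_set_max (finF _ FB) B0.
    by exists m; split => // q mq qm; split => // Bq; case: qm; exact: wo_anti (mmax _ Bq) mq.
  pose P := [set p | exists2 A, F' A & A p /\ forall x, A x -> R x p].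
  have hasmax A : F' A -> exists2 m, A m & forall x, A x -> R x m.
    move=> FA; apply: finite_set_max; first exact: finF.
    by apply: contrapT => h; apply: nF0; rewrite (_ : set0 = A) //;
      apply/esym; rewrite -subset0 => x Ax; case: h; exists x.
  have [|q Pq qmin] := @wo_set_min P.
    by have [m Am mm] := hasmax _ FA0; exists m; exists A0.
  (* The members with maximum [q], deprived of [q]: their elements lie strictly below [q], so [rec]
     applies. *)
  pose F'' := [set C | ~ C q /\ F' (C `|` [set q]) /\ forall x, C x -> R x q].
  have F''P A : F' A -> A q -> (forall x, A x -> R x q) ->
      F'' (A `\ q) /\ (A `\ q) `|` [set q] = A.
    move=> FA Aq Amax.
    have e : (A `\ q) `|` [set q] = A.
      apply/seteqP; split => x; first by case=> [[]//|->].
      by move=> Ax; have [->|xq] := pselect (x = q); [right|left].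
    by split => //; split; [case=> _; apply|rewrite e; split => // x [Ax _]; exact: Amax].
  have [|||C [nCq [FC CR]] Cmin] := rec q F''.
  - move=> C [nCq [FC CR]]; split.
      by have := finF _ FC; rewrite finite_setU => -[].
    by move=> x Cx; split; [exact: CR|move=> e; apply: nCq; rewrite -e].
  - exact: Pq.
  - by case: Pq => A FA [Aq Amax]; exists (A `\ q); case: (F''P A).
  exists (C `|` [set q]) => // B FB.
  have [m Bm mmax] := hasmax _ FB.
  have qm : R q m by apply: qmin; exists B.
  have [mq|mq] := pselect (m = q); last first.
    right; exists m; split => //.
      by case=> [/CR mq'|//]; apply: mq; exact: wo_anti mq' qm.
    move=> r mr rm; split; last by move=> Br; case: rm; exact: wo_anti (mmax _ Br) mr.
    case=> [/CR rq|rq]; last by case: mq; apply: wo_anti qm; rewrite -rq.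
    by case: rm; apply: wo_anti mr; exact: wo_trans rq qm.
  subst m; have [F''B eB] := F''P _ FB Bm mmax.
  have [eC|[p [Bp nCp eqp]]] := Cmin _ F''B; first by left; rewrite eC eB.
  case: Bp => Bp pq; right; exists p; split => //; first by case.
  move=> r pr rp; have := eqp r pr rp.
  have [->|rq] := pselect (r = q); last first.
    by case=> h1 h2; split=> [[/h1[]//|//]|Br]; left; apply: h2; split.
  by move=> _; split => // _; right.
move=> finF F0; apply: (step) => // p F' F'P _.
suff key : forall G, (forall A, G A -> finite_set A /\ forall x, A x -> R x p /\ x <> p) ->
  G !=set0 -> exists2 A, G A & forall B, G B -> A = B \/ colex A B by exact: key.
move=> {F F' F'P finF F0}; apply: contrapT => nkey.
(* A least bound [q] at which minimisation fails; [step] only asks for a bound [r] belonging to some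
   member, hence strictly below [q]. *)
have [|q nq qmin] := @wo_set_min [set p | ~ forall G,
    (forall A, G A -> finite_set A /\ forall x, A x -> R x p /\ x <> p) ->
  G !=set0 -> exists2 A, G A & forall B, G B -> A = B \/ colex A B].
  by exists p.
apply: nq => G GP G0; apply: step => //; first by move=> A /GP[].
move=> r F'' F''P [A GA [Ar _]] F''0; apply: contrapT => nr.
have [rq nrq] := (GP A GA).2 r Ar; apply: nrq; apply: wo_anti rq _.
by apply: qmin => h; apply: nr; exact: h.
Qed.

End Colex.

(** * Minimal cuts *)

Lemma seq_maximal (T : eqType) (r : T -> T -> Prop) (a : T) (s : seq T) :
    (forall x y z, r x y -> r y z -> r x z) -> (forall x, ~ r x x) ->
  exists2 m, m \in a :: s & forall b, b \in a :: s -> ~ r m b.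
Proof.
move=> tr irr; elim: s a => [|b s ih] a.
  by exists a; rewrite ?inE // => b; rewrite inE => /eqP ->.
have [m ms mmax] := ih b; have [ma|nma] := pselect (r m a); last first.
  by exists m => [|c]; rewrite inE ?ms ?orbT // => /orP[/eqP->//|]; exact: mmax.
exists a => [|c]; first by rewrite mem_head.
rewrite inE => /orP[/eqP->//|cs ac]; apply: (mmax c cs); exact: tr ac.
Qed.

(* [P1], [P2], [P3] and [P4] stand for the corners [a & b], [a & ~b], [~a & b]
   and [~a & ~b] separating the two points; [Q] says that [b] separates them. *)
Lemma separated_corners (ax ay bx by_ P1 P2 P3 P4 Q : Prop) : ~ (ax <-> ay) ->
    (~ (ax /\ bx <-> ay /\ by_) -> P1) -> (~ (ax /\ ~ bx <-> ay /\ ~ by_) -> P2) ->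
    (~ (~ ax /\ bx <-> ~ ay /\ by_) -> P3) ->
    (~ (~ ax /\ ~ bx <-> ~ ay /\ ~ by_) -> P4) -> (~ (bx <-> by_) -> Q) ->
  [\/ P1 /\ P3, P2 /\ P4, P1 /\ P4 /\ Q | P2 /\ P3 /\ Q].
Proof.
move=> s h1 h2 h3 h4 hQ; have [ax_|nax] := pselect ax; have [ay_|nay] := pselect ay;
  try (by case: s; split); have [bx_|nbx] := pselect bx; have [bys|nby] := pselect by_;
  [constructor 1|constructor 3|constructor 4|constructor 2
  |constructor 1|constructor 4|constructor 3|constructor 2];
  repeat split; first [apply h1|apply h2|apply h3|apply h4|apply hQ];
  clear s h1 h2 h3 h4 hQ; tauto.
Qed.

Section MinCuts.
Context {L : Type} {T : eqType} {R : rel T} {C : set (set L)} {bd : set L -> set T}.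
Hypothesis R_wo : well_order R.
Hypothesis CC : forall a, C a -> C (~` a).
Hypothesis CI : forall a b, C a -> C b -> C (a `&` b).
Hypothesis bd_finite : forall a, C a -> finite_set (bd a).
Hypothesis bdC : forall a, bd (~` a) = bd a.
Hypothesis bdIU_subU : forall a b, bd (a `&` b) `|` bd (a `|` b) `<=` bd a `|` bd b.
Hypothesis bdIU_subI : forall a b, bd (a `&` b) `&` bd (a `|` b) `<=` bd a `&` bd b.
Hypothesis bd_inj : forall a b, C a -> C b -> bd a = bd b -> a = b \/ a = ~` b.
Hypothesis C_sep : forall x y : L, x <> y -> exists2 c, C c & ~ (c x <-> c y).

Local Notation lt := (fun a b => colex (R := R) (bd a) (bd b)).

(** Every other separating cut must cost strictly more, so uniqueness up to complement is built in;
    [mincut_exists] gets it from [bd_inj]. *)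
Definition mincut (a : set L) (x y : L) := [/\ C a, ~ (a x <-> a y) &
  forall c, C c -> ~ (c x <-> c y) -> c <> a -> c <> ~` a -> lt a c].

Lemma mincut_exists x y : x <> y -> exists a, mincut a x y.
Proof.
move=> xy; pose F := bd @` [set c | C c /\ ~ (c x <-> c y)].
have [||A [a [Ca axy] <-] amin] := @colex_min _ _ R_wo F.
- by move=> _ [c [Cc _] <-]; exact: bd_finite.
- by have [c Cc cxy] := C_sep xy; exists (bd c), c.
exists a; split => // c Cc cxy ca cNa; case: (amin (bd c)) => //; first by exists c.
by move=> /(bd_inj Ca Cc)[e|e]; [case: ca|case: cNa; rewrite e setCK].
Qed.

Lemma mincutC a x y : mincut a x y -> mincut (~` a) x y.
Proof.
move=> [Ca axy amin]; split; first exact: CC.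
- by move=> h; apply: axy; split => h'; apply: contrapT => h''; case: h => /= ? ?; tauto.
- by move=> c Cc cxy ca cNa; rewrite bdC; apply: amin => //; rewrite -[a]setCK.
Qed.

(** If all four corners were nonempty, none would be [a], [b] or a complement of these, so a corner
    separating a pair would cost more than the minimal cut of that pair. Submodularity refutes
    this. *)
Lemma mincut_noncrossing a b x y u v : mincut a x y -> mincut b u v ->
  [\/ a `&` b = set0, a `&` ~` b = set0, ~` a `&` b = set0 | ~` a `&` ~` b = set0].
Proof.
move=> [Ca axy amin] [Cb buv bmin]; apply: contrapT => ncr.
have [[p1 [ap1 bp1]] [p2 [ap2 bp2]] [p3 [ap3 bp3]] [p4 [ap4 bp4]]] :
  [/\ a `&` b !=set0, a `&` ~` b !=set0, ~` a `&` b !=set0 & ~` a `&` ~` b !=set0].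
  by split; apply/set0P; apply: contra_notN ncr => /eqP e;
    [constructor 1|constructor 2|constructor 3|constructor 4].
(* Of two opposite corners, one cannot cost more than [a] while the other costs more than [b]. *)
have opp c d S1 S2 : bd c = bd a -> bd d = bd b ->
    bd S1 = bd (c `&` d) -> bd S2 = bd (c `|` d) ->
    (lt a S1 -> lt b S2 -> False) /\ (lt a S2 -> lt b S1 -> False).
  move=> <- <- -> ->; split; apply: (colex_submodular R_wo) => //.
  - by rewrite setUC; exact: bdIU_subU.
  - by rewrite setIC; exact: bdIU_subI.
have [o14 o41] := opp a b (a `&` b) (~` a `&` ~` b) erefl erefl erefl
  ltac:(by rewrite -setCU bdC).
have [o23 o32] := opp a (~` b) (a `&` ~` b) (~` a `&` b) erefl (bdC b) erefl
  ltac:(by rewrite -[in LHS](setCK b) -setCU bdC).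
have oab : lt a b -> lt b a -> False.
  by apply: (colex_submodular R_wo); rewrite 1?setUC 1?setIC.
have [CNa CNb] := (CC Ca, CC Cb).
have neq (c d : set L) p : c p -> ~ d p -> c <> d by move=> cp ndp e; apply: ndp; rewrite -e.
have neq' (c d : set L) p : ~ c p -> d p -> c <> d by move=> cp ndp e; apply: cp; rewrite e.
have a1 : ~ ((a `&` b) x <-> (a `&` b) y) -> lt a (a `&` b).
  by move=> s; apply: amin => //; [exact: CI|apply: (neq' _ _ p2) => // -[]|
    apply: (neq _ _ p1) => //; exact].
have a2 : ~ ((a `&` ~` b) x <-> (a `&` ~` b) y) -> lt a (a `&` ~` b).
  by move=> s; apply: amin => //; [exact: CI|apply: (neq' _ _ p1) => // -[]|
    apply: (neq _ _ p2) => //; exact].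
have a3 : ~ ((~` a `&` b) x <-> (~` a `&` b) y) -> lt a (~` a `&` b).
  by move=> s; apply: amin => //; [exact: CI|apply: (neq _ _ p3)|
    apply: (neq' _ _ p4) => // -[]].
have a4 : ~ ((~` a `&` ~` b) x <-> (~` a `&` ~` b) y) -> lt a (~` a `&` ~` b).
  by move=> s; apply: amin => //; [exact: CI|apply: (neq _ _ p4)|
    apply: (neq' _ _ p3) => // -[]].
have b1 : ~ ((a `&` b) u <-> (a `&` b) v) -> lt b (a `&` b).
  by move=> s; apply: bmin => //; [exact: CI|apply: (neq' _ _ p3) => // -[]|
    apply: (neq _ _ p1) => //; exact].
have b2 : ~ ((a `&` ~` b) u <-> (a `&` ~` b) v) -> lt b (a `&` ~` b).
  by move=> s; apply: bmin => //; [exact: CI|apply: (neq _ _ p2)|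
    apply: (neq' _ _ p4) => // -[]].
have b3 : ~ ((~` a `&` b) u <-> (~` a `&` b) v) -> lt b (~` a `&` b).
  by move=> s; apply: bmin => //; [exact: CI|apply: (neq' _ _ p1) => // -[]|
    apply: (neq _ _ p3) => //; exact].
have b4 : ~ ((~` a `&` ~` b) u <-> (~` a `&` ~` b) v) -> lt b (~` a `&` ~` b).
  by move=> s; apply: bmin => //; [exact: CI|apply: (neq _ _ p4)|
    apply: (neq' _ _ p2) => // -[]].
have ab : ~ (b x <-> b y) -> lt a b.
  by move=> s; apply: amin => //; [apply: (neq _ _ p3)|apply: (neq _ _ p1) => //; exact].
have ba : ~ (a u <-> a v) -> lt b a.
  by move=> s; apply: bmin => //; [apply: (neq _ _ p2)|apply: (neq _ _ p1) => //; exact].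
(* Each pair yields one of four patterns of costly corners. A pattern for [x], [y] and one for [u],
   [v] always contain two opposite corners, or both [lt a b] and [lt b a]. *)
have := separated_corners axy a1 a2 a3 a4 ab.
rewrite setIC in b1; rewrite [_ `&` ~` b]setIC in b2.
rewrite [~` a `&` _]setIC in b3; rewrite [~` a `&` ~` b]setIC in b4.
have := separated_corners buv b1 b3 b2 b4 ba; rewrite ![_ `&` a]setIC ![_ `&` ~` a]setIC.
by case=> [[]|[]|[? []]|[? []]] + + []; intuition.
Qed.

Variable pt : L.

(** Keeping the side that misses [pt] rules out disjoint complements, the one noncrossing position
    that is not laminar. *)
Definition tree : set (set L) := [set a | ~ a pt /\ exists x y, mincut a x y].

Lemma tree_sub : tree `<=` C.
Proof. by move=> a [_ [x [y []]]]. Qed.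

Lemma tree_separates x y : x <> y -> exists2 a, tree a & ~ (a x <-> a y).
Proof.
move=> /mincut_exists[a am]; have [apt|napt] := pselect (a pt); last first.
  by exists a; [split => //; exists x, y|case: am].
have amC := mincutC am; exists (~` a); last by case: amC.
by split; [exact|exists x, y].
Qed.

Lemma tree_laminar a b : tree a -> tree b ->
  [\/ a `&` b = set0, a `<=` b | b `<=` a].
Proof.
move=> [apt [x [y am]]] [bpt [u [v bm]]].
case: (mincut_noncrossing am bm) => h.
- by constructor 1.
- by constructor 2; rewrite -[b]setCK -disjoints_subset.
- by constructor 3; rewrite -[a]setCK -disjoints_subset setIC.
- by have : (~` a `&` ~` b) pt by []; rewrite h.
Qed.

Lemma tree_witness a : tree a -> exists x y, [/\ a x, ~ a y &
  forall c, tree c -> c <> a -> ~ (c x <-> c y) -> lt a c].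
Proof.
move=> [apt [x [y [Ca axy amin]]]].
have key c : tree c -> c <> a -> ~ (c x <-> c y) -> lt a c.
  move=> tc ca cxy; apply: amin => //; first exact: tree_sub.
  by move=> e; case: tc; rewrite e.
have [ax|nax] := pselect (a x).
  by exists x, y; split => // ay; apply: axy.
exists y, x; split => //.
- by apply: contrapT => nay; apply: axy; split.
- by move=> c tc ca cyx; apply: key => // h; apply: cyx; split => ?; apply h.
Qed.

(* If [s] partitions [a], then a pair of points whose minimal cut is one of
   [a] and the members of [s] is also separated by another one of these sets,
   which therefore has a larger cost; so none of them has a maximal cost. *)
Lemma tree_not_cover a (s : seq (set L)) : tree a ->
  (forall c, c \in s -> [/\ tree c, c `<=` a & c <> a]) ->
  ~ (forall x, a x -> exists2 c, c \in s & c x).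
Proof.
move=> ta; have [n] := ubnP (size s); elim: n s => // n ih s; rewrite ltnS => sn sP cov.
(* A member contained in another one is discarded, which shortens [s]; otherwise distinct members
   are disjoint by laminarity. *)
have [[c [c' [cs c's cc' sub]]]|nonest] :=
    pselect (exists c c', [/\ c \in s, c' \in s, c <> c' & c `<=` c']).
  apply: (ih [seq d <- s | d != c]).
  - apply: leq_trans sn; rewrite size_filter ltn_neqAle count_size andbT -all_count.
    by apply/allPn; exists c => //; rewrite eqxx.
  - by move=> d; rewrite mem_filter => /andP[_ /sP].
  move=> x /cov[d ds dx]; have [e|dc] := eqVneq d c; last by exists d; rewrite // mem_filter dc.
  exists c'; last by apply: sub; rewrite -e.
  by rewrite mem_filter c's andbT; apply/eqP => e'; apply: cc'.
have [||m ms mmax] := @seq_maximal _ lt a s.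
- by move=> ? ? ?; exact: (colex_trans R_wo).
- by move=> ?; exact: colex_irr.
move: ms; rewrite inE => /orP[/eqP e|ms].
  subst m; have [x [y [ax nay amin]]] := tree_witness ta.
  have [c cs cx] := cov x ax; have [tc ca nca] := sP c cs.
  apply: (mmax c); first by rewrite inE cs orbT.
  by apply: amin => // h; apply/nay/ca/h.
have [tm ma nma] := sP m ms; have [x [y [mx nmy mmin]]] := tree_witness tm.
(* If [y] is outside [a], then [a] separates the witnesses of [m]; otherwise the member of [s]
   containing [y] does. *)
have [ay|nay] := pselect (a y); last first.
  apply: (mmax a); first by rewrite mem_head.
  by apply: mmin => // [e|h]; [apply: nma|apply/nay/h/ma].
have [c cs cy] := cov y ay; have [tc ca nca] := sP c cs.
have cm : c <> m by move=> e; apply: nmy; rewrite -e.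
apply: (mmax c); first by rewrite inE cs orbT.
apply: mmin => // h; have cx : c x by apply/h.
case: (tree_laminar tc tm) => [e|cm'|mc].
- by have : (c `&` m) x by []; rewrite e.
- by apply: nonest; exists c, m.
- by apply: nonest; exists m, c; split => // e; apply: cm.
Qed.

End MinCuts.

(** * Clopen sets in subspaces of a cube *)

Lemma clopen_connected (T : topologicalType) :
  (forall (B : set T) x y, clopen B -> B x -> B y) -> connected [set: T].
Proof.
move=> h B [x Bx] [C oC BC] [D cD BD]; rewrite !setTI in BC BD.
by apply/seteqP; split => // y _; apply: (h B x y) => //; split; rewrite 1?BC -1?BD ?BD //; subst.
Qed.

Lemma connected_clopen (T : topologicalType) (B : set T) x y :
  connected [set: T] -> clopen B -> B x -> B y.
Proof.
move=> cT [oB cB] Bx; have -> // : B = setT.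
by apply: cT; [exists x|exists B; rewrite ?setTI|exists B; rewrite ?setTI].
Qed.

Lemma cluster_closed (T : topologicalType) (F : set_system T) (B : set T) (p : T) :
  closed B -> F B -> cluster F p -> B p.
Proof. by move=> cB FB; rewrite clusterE => /(_ B FB); exact: cB. Qed.

Lemma compact_set_type (T : topologicalType) (A : set T) :
  compact A -> compact [set: set_type A].
Proof.
move=> cA F FF _.
have FA : (set_val @ F) A.
  by apply: (@filterS _ F _ setT); [move=> x _; exact: set_valP|exact: filterT].
have [p [Ap clp]] := cA (set_val @ F) _ FA.
exists (SigSub (mem_set Ap)); split => // P W FP [_ [[V oV <-] Vp] VW].
have FsP : (set_val @ F) (set_val @` P).
  by apply: (@filterS _ F _ P) => // x Px; exists x.
have [|_ [[x Px <-] Vx]] := clp _ V FsP; first exact: open_nbhs_nbhs.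
by exists x; split => //; exact: VW.
Qed.

Lemma hausdorff_set_type (T : topologicalType) (A : set T) :
  hausdorff_space T -> hausdorff_space (set_type A).
Proof.
move=> hT p q pq; apply: val_inj; apply: hT => U V nU nV.
have sc := @initial_continuous (set_type A) T set_val.
by have [x [Ux Vx]] := pq _ _ (sc p _ nU) (sc q _ nV); exists (set_val x).
Qed.

Section Cube.
Context {R : realType} {I : choiceType}.
Implicit Types (A : set {ptws I -> R}) (i j : I) (t : R).

Lemma set_type_proj_continuous A i : continuous (fun k : set_type A => (set_val k : I -> R) i).
Proof.
move=> k; apply: (@continuous_comp _ _ _ set_val (fun f : {ptws I -> R} => f i)).
  exact: initial_continuous.
exact: (@proj_continuous I (fun=> R) i).
Qed.

Lemma closed_coord i (C : set R) : closed C ->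
  closed [set k : {ptws I -> R} | C (k i)].
Proof.
move=> cC; apply: (@preimage_closed {ptws I -> R} R (fun k => k i)) => // k _.
exact: (@proj_continuous I (fun=> R) i).
Qed.

(** Otherwise each finite [S] has a pair agreeing on [S] with only its first entry in [B]. A cluster
    point of these pairs is diagonal, yet [B] and its complement are closed. *)
Lemma clopen_finitely_determined A (B : set (set_type A)) :
  compact [set: set_type A] -> clopen B ->
  exists s : seq I, forall k l : set_type A,
    {in s, (set_val k : I -> R) =1 (set_val l : I -> R)} -> B k -> B l.
Proof.
move=> cK [oB cB]; apply: contrapT => ndet.
(* Finiteness is a premise under the existential so that [choice] ranges over all sets; an infinite
   [S] gets an arbitrary pair. *)
have bad (S : set I) : exists kl : set_type A * set_type A, finite_set S ->
    [/\ forall i, S i -> (set_val kl.1 : I -> R) i = (set_val kl.2 : I -> R) i,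
        B kl.1 & ~ B kl.2].
  have [/finite_seqP[s ->]|nfin] := pselect (finite_set S); last first.
    by apply: contrapT => h; apply: ndet; exists [::] => k; case: h; exists (k, k).
  apply: contrapT => h; apply: ndet; exists s => k l kl Bk; apply: contrapT => nBl.
  by apply: h; exists (k, l) => _; split.
have [kl klP] := choice bad.
pose F := kl @ largeFin.
have FF : ProperFilter F by exact: fmap_proper_filter.
have FX : F ([set: set_type A] `*` [set: set_type A]).
  by apply: (@filterS _ _ _ setT); [split|exact: filterT].
have [[p q] [_ clpq]] := compact_setX cK cK FF FX.
have Bp : B p.
  have : (B \o fst) (p, q); last by [].
  apply: cluster_closed clpq; first by apply: preimage_closed => // z _; exact: cvg_fst.
  by exists set0 => // S [finS _]; case: (klP S finS).
have nBq : ~ B q.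
  have : ((~` B) \o snd) (p, q); last by [].
  apply: cluster_closed clpq.
    by apply: preimage_closed; [move=> z _; exact: cvg_snd|exact: open_closedC].
  by exists set0 => // S [finS _]; case: (klP S finS).
suff e : p = q by rewrite e in Bp.
apply: val_inj; apply/funext => i; apply/eqP; rewrite -subr_eq0; apply/eqP.
pose dif (z : set_type A * set_type A) : R :=
  (set_val z.1 : I -> R) i - (set_val z.2 : I -> R) i.
have : (dif @^-1` [set 0]) (p, q); last by [].
apply: cluster_closed clpq.
  apply: preimage_closed; last exact: closed_eq.
  move=> z _; apply: (@cvgB _ R).
    apply: (@continuous_comp _ _ _ fst (fun k : set_type A => (set_val k : I -> R) i)).
      exact: cvg_fst.
    exact: set_type_proj_continuous.
  apply: (@continuous_comp _ _ _ snd (fun k : set_type A => (set_val k : I -> R) i)).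
    exact: cvg_snd.
  exact: set_type_proj_continuous.
exists [set i] => // S [finS iS]; case: (klP S finS) => e _ _.
by rewrite /= /dif e ?subrr //; exact: iS.
Qed.

(** A retraction onto the unit interval: it extends a coordinate segment to a path defined on the
    whole connected line. *)
Definition clamp t : R := Num.max 0 (Num.min 1 t).

Lemma clamp_itv t : 0 <= clamp t <= 1.
Proof. by rewrite /clamp le_max lexx /= ge_max ler01 ge_min lexx. Qed.

Lemma clamp_id t : 0 <= t <= 1 -> clamp t = t.
Proof. by move=> /andP[t0 t1]; rewrite /clamp min_r // max_r. Qed.

Lemma clamp_continuous : continuous clamp.
Proof.
apply: max_fun_continuous; first exact: cst_continuous.
by apply: min_fun_continuous; [exact: cst_continuous|move=> x; exact: cvg_id].
Qed.

Definition update (f : I -> R) i t : I -> R := dfwith f i t.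

Lemma clopen_update A (B : set (set_type A)) (k l : set_type A) i : clopen B ->
    (forall t, 0 <= t <= 1 -> A (update (set_val k) i t)) ->
    0 <= (set_val k : I -> R) i <= 1 ->
    (exists2 t, 0 <= t <= 1 & set_val l = update (set_val k) i t) ->
  B k -> B l.
Proof.
move=> cB Ak ki [t t01 el].
have Ag u : A (update (set_val k) i (clamp u)) by apply: Ak; exact: clamp_itv.
pose g (u : R) : set_type A := SigSub (mem_set (Ag u)).
have cg : continuous g.
  apply: continuous_comp_initial => u.
  apply: (@continuous_comp _ _ _ clamp (fun u => update (set_val k) i u : {ptws I -> R})).
    exact: clamp_continuous.
  exact: (@dfwith_continuous I (fun=> R)).
have -> : k = g ((set_val k : I -> R) i).
  apply: val_inj; rewrite /= clamp_id //; apply/funext => j.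
  by rewrite /update; case: dfwithP.
have -> : l = g t by apply: val_inj; rewrite /= clamp_id.
apply: (@connected_clopen R (g @^-1` B)); last exact: preimage_clopen.
by apply/connected_intervalP.
Qed.

End Cube.

(** * The space of weightings of a laminar family *)

Section TreeSpace.
Context {R : realType} {X : Type} {G : set (set X)}.
Hypothesis G_laminar : forall a b, G a -> G b ->
  [\/ a `&` b = set0, a `<=` b | b `<=` a].
Hypothesis G_not_cover : forall a (s : seq (set X)), G a ->
  (forall c, c \in s -> [/\ G c, c `<=` a & c <> a]) ->
  ~ (forall x, a x -> exists2 c, c \in s & c x).
Implicit Types (a b c : set X) (k : set X -> R) (s : seq (set X)).

Definition nested a b := [/\ G a, G b, a `<=` b & a <> b].
Definition apart a b := [/\ G a, G b & a `&` b = set0].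

(** Indexing by all sets, with value 0 outside [G], keeps the ambient space a plain power of [R]. *)
Definition weighting : set {ptws set X -> R} := [set k | [/\
  forall a, 0 <= k a <= 1,
  forall a, ~ G a -> k a = 0,
  forall a b, nested a b -> k a = 0 \/ k b = 1 &
  forall a b, apart a b -> k a = 0 \/ k b = 0]].

Lemma weighting_compact : compact weighting.
Proof.
have cub : compact [set k : {ptws set X -> R} | forall a, (`[0, 1]%classic : set R) (k a)].
  have c01 : compact (`[0, 1]%classic : set R) := @segment_compact R 0 1.
  have := @tychonoff (set X) (fun=> R : topologicalType) (fun=> `[0, 1]%classic) (fun=> c01).
  exact.
apply: (subclosed_compact _ cub); last first.
  by move=> k [k01 _ _ _] a /=; rewrite in_itv; exact: k01.
have -> : weighting = (\bigcap_a [set k : {ptws set X -> R} | (`[0, 1]%classic : set R) (k a)])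
  `&` (\bigcap_(a in ~` G) [set k : {ptws set X -> R} | [set 0] (k a)])
  `&` (\bigcap_(p in [set p | nested p.1 p.2])
        ([set k : {ptws set X -> R} | [set 0] (k p.1)] `|` [set k | [set 1] (k p.2)]))
  `&` (\bigcap_(p in [set p | apart p.1 p.2])
        ([set k : {ptws set X -> R} | [set 0] (k p.1)] `|` [set k | [set 0] (k p.2)])).
  apply/seteqP; split => k.
    move=> [k01 kG kn ka]; split; [split; [split|]|].
    - by move=> a _ /=; rewrite in_itv; exact: k01.
    - by move=> a; exact: kG.
    - by move=> [a b]; exact: kn.
    - by move=> [a b]; exact: ka.
  move=> [[[k01 kG] kn] ka]; split.
  - by move=> a; have := k01 a I; rewrite /= in_itv.
  - by move=> a; exact: kG.
  - by move=> a b ab; exact: (kn (a, b)).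
  - by move=> a b ab; exact: (ka (a, b)).
have c1 (x : R) : closed [set x] by exact: closed_eq.
apply: closedI; [apply: closedI; [apply: closedI|]|]; apply: closed_bigI.
- by move=> a _; apply: (@closed_coord R _ a `[0, 1]%classic); exact: interval_closed.
- by move=> a _; apply: (@closed_coord R).
- by move=> p _; apply: closedU; apply: (@closed_coord R).
- by move=> p _; apply: closedU; apply: (@closed_coord R).
Qed.

Definition point_weighting (z : X) : set X -> R := fun a => (`[< G a /\ a z >])%:R.

Lemma point_weightingE z a : G a -> point_weighting z a = (`[< a z >])%:R.
Proof.
move=> Ga; rewrite /point_weighting; congr (_ %:R); congr nat_of_bool.
by apply: asbool_equiv_eq; tauto.
Qed.

Lemma point_weightingP z : weighting (point_weighting z).
Proof.
split.
- by move=> a; rewrite /point_weighting; case: asboolP; rewrite ?lexx ler01.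
- by move=> a nGa; rewrite /point_weighting asboolF // => -[].
- move=> a b [Ga Gb ab _]; rewrite !point_weightingE //.
  by have [az|naz] := pselect (a z); [right; rewrite asboolT //; exact: ab|left; rewrite asboolF].
- move=> a b [Ga Gb ab]; rewrite !point_weightingE //.
  have [az|naz] := pselect (a z); [right|left]; rewrite asboolF // => bz.
  by have : (a `&` b) z by []; rewrite ab.
Qed.

(* The least weighting that agrees with [k] on [s]. *)
Definition spread k s : set X -> R := fun c => if c \in s then k c else
  (`[< G c /\ exists a, [/\ a \in s, k a <> 0 & nested a c] >])%:R.

Lemma spread_neq0 k s c : weighting k -> spread k s c <> 0 ->
  exists a, [/\ a \in s, k a <> 0, G a, a `<=` c & c = a \/ nested a c].
Proof.
move=> [_ kG _ _]; rewrite /spread; case: ifP => cs.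
  move=> kc; exists c; split => //; last by left.
  by apply: contrapT => /kG.
case: asboolP => // -[Gc [a [as_ ka an]]] _; exists a.
by split => //; [case: an|case: an|right].
Qed.

Lemma nested_trans a b c : nested a b -> nested b c -> nested a c.
Proof.
move=> [Ga Gb ab nab] [_ Gc bc nbc]; split => //; first exact: subset_trans bc.
by move=> e; subst c; apply: nab; apply/seteqP; split.
Qed.

(** A nonzero value comes from a set of [s] that lies inside and has nonzero weight under [k], so
    both conditions reduce to those on [k]. *)
Lemma spreadP k s : weighting k -> weighting (spread k s).
Proof.
move=> kw; have [k01 kG kn ka] := kw; split.
- move=> a; rewrite /spread; case: ifP => // _.
  by case: asboolP; rewrite ?lexx ler01.
- move=> a nGa; rewrite /spread; case: ifP => _; first exact: kG.
  by rewrite asboolF // => -[].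
- move=> a b ab; have [|sa] := pselect (spread k s a = 0); first by left.
  right; have [c [cs kc Gc ca can]] := spread_neq0 kw sa.
  have cb : nested c b by case: can => [<-//|/nested_trans]; apply.
  rewrite /spread; case: ifP => bs; first by case: (kn c b cb).
  by rewrite asboolT //; split; [case: cb|exists c].
- move=> a b [Ga Gb ab]; have [|sa] := pselect (spread k s a = 0); first by left.
  right; apply: contrapT => sb.
  have [c [cs kc Gc ca _]] := spread_neq0 kw sa.
  have [d [ds kd Gd db _]] := spread_neq0 kw sb.
  have [] // := ka c d; split => //; rewrite -subset0 -ab => x [cx dx].
  by split; [exact: ca|exact: db].
Qed.

Lemma weighting_connected : connected [set: set_type weighting].
Proof.
have cK : compact [set: set_type weighting].
  by apply: compact_set_type; exact: weighting_compact.
apply: clopen_connected.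
have zP : weighting (fun=> 0).
  by split => *; rewrite ?lexx ?ler01 //; left.
pose z : set_type weighting := SigSub (mem_set zP).
(* Two complementary clopen sets cannot both contain the zero weighting. *)
suff key (B : set (set_type weighting)) (k : set_type weighting) : clopen B -> B k -> B z.
  move=> B x y cB Bx; apply: contrapT => nBy.
  have := key (~` B) y (clopenC set0 cB) nBy; apply.
  exact: key Bx.
move=> cB; have [s sB] := clopen_finitely_determined cK cB.
(* Induction on the number of coordinates in [s] with nonzero weight. *)
have [n] := ubnP (count (fun a => (set_val k : set X -> R) a != 0) s).
elim: n k => // n ih k; rewrite ltnS => kn Bk.
pose kf := set_val k : set X -> R.
have kw : weighting kf := set_valP k.
pose t := [seq a <- s | kf a != 0].
case et : t => [|a0 t0].
  apply: (sB k) => // a as_ /=; apply/eqP; apply: contraT => kan.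
  by have : a \in t; [rewrite mem_filter kan|rewrite et].
(* The order is reversed inclusion, so [a] is innermost among the sets of [s] with nonzero
   weight. *)
have [||a at_ amin] := @seq_maximal _ (fun a b => b `<=` a /\ a <> b) a0 t0.
- move=> x y w [yx xy] [wy yw]; split; first exact: subset_trans yx.
  by move=> e; subst w; apply: xy; apply/seteqP; split.
- by move=> x [].
rewrite -et mem_filter in at_; have /andP[/eqP ka as_] := at_.
have {}amin b : b \in s -> kf b <> 0 -> b `<=` a -> a = b.
  move=> bs kb ba; apply: contrapT => ab; apply: (amin b) => //.
  by rewrite -et mem_filter bs andbT; apply/eqP.
have k1w := spreadP s kw.
pose k1 : set_type weighting := SigSub (mem_set k1w).
have k1E b : b \in s -> spread kf s b = kf b by move=> bs; rewrite /spread bs.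
have Bk1 : B k1 by apply: (sB k) => // b bs; rewrite [RHS]k1E.
have Ga : G a by apply: contrapT => nGa; apply: ka; case: kw => _ kG _ _; exact: kG.
(* After the reset the weight of [a] is free: sets strictly above [a] have weight 1, sets apart from
   it have weight 0, and so do sets strictly below it because [a] is innermost. *)
have uw u : 0 <= u <= 1 -> weighting (update (spread kf s) a u).
  move=> u01; have [k01 kG kne kap] := k1w.
  have upa : update (spread kf s) a u a = u by rewrite /update dfwithin.
  have upn b : b <> a -> update (spread kf s) a u b = spread kf s b.
    by move=> /eqP ba; rewrite /update dfwithout // eq_sym.
  split.
  - by move=> b; have [->|/upn->] := pselect (b = a); rewrite ?upa.
  - move=> b nGb; rewrite upn; first exact: kG.
    by move=> e; apply: nGb; rewrite e.
  - move=> b c bc; have [ea|ba] := pselect (b = a).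
      subst b; rewrite (upn c); last by case: bc => _ _ _ ac e; apply: ac.
      by right; case: (kne a c bc) => //; rewrite k1E.
    rewrite (upn b) //; have [ec|/upn->] := pselect (c = a); last exact: kne.
    subst c; left; apply: contrapT => /(spread_neq0 kw)[d [ds kd Gd db _]].
    case: bc => Gb _ sba _; have e := amin d ds kd (subset_trans db sba).
    by subst d; apply: ba; apply/seteqP; split.
  - move=> b c bc; have [Gb Gc bc0] := bc; have [eb|ba] := pselect (b = a).
      subst b; right; rewrite upn; last first.
        move=> e; subst c; case: (kap a a bc); rewrite k1E //.
      by case: (kap a c bc) => //; rewrite k1E.
    rewrite (upn b) //; have [ec|/upn->] := pselect (c = a); last exact: kap.
    by subst c; left; case: (kap b a bc) => //; rewrite k1E.
have u0w : weighting (update (spread kf s) a 0) by apply: uw; rewrite lexx ler01.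
pose k0 : set_type weighting := SigSub (mem_set u0w).
apply: (ih k0); last first.
  apply: (clopen_update (k := k1) (i := a)) Bk1 => //.
    by have [k01 _ _ _] := k1w; exact: k01.
  by exists 0; rewrite ?lexx ?ler01.
(* On [s] the new weighting differs from [k] only at [a], so the count drops. *)
apply: leq_trans kn => /=.
have -> : count (fun b => update (spread kf s) a 0 b != 0) s =
    count (predI (predC1 a) (fun b => kf b != 0)) s.
  apply: eq_in_count => b bs /=; have [->|ba] := eqVneq b a.
    by rewrite /update dfwithin eqxx.
  by rewrite /update dfwithout ?k1E // eq_sym.
rewrite -2!size_filter filter_predI -/t [ltnLHS]size_filter ltn_neqAle count_size andbT -all_count.
by apply/allPn; exists a; rewrite /= ?eqxx // mem_filter as_ andbT; apply/eqP.
Qed.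

Definition point_element z : set_type weighting := SigSub (mem_set (point_weightingP z)).

Lemma point_elementE z a : G a ->
  (set_val (point_element z) : set X -> R) a = (`[< a z >])%:R.
Proof. exact: point_weightingE. Qed.

Definition level_sets a : set (set_type weighting) * set (set_type weighting) :=
  ([set k | (set_val k : set X -> R) a = 1], [set k | (set_val k : set X -> R) a <> 0]).

Lemma level_sets_pseudoclopen a : pseudoclopen (level_sets a).
Proof.
split => /=.
- apply: (@preimage_closed _ _ (fun k : set_type weighting => (set_val k : set X -> R) a)
    [set 1]); last exact: closed_eq.
  by move=> k _; exact: (@set_type_proj_continuous R (set X) weighting a k).
- apply: closed_openC.
  apply: (@preimage_closed _ _ (fun k : set_type weighting => (set_val k : set X -> R) a)
    [set 0]); last exact: closed_eq.
  by move=> k _; exact: (@set_type_proj_continuous R (set X) weighting a k).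
- by move=> k /= ->; apply/eqP; exact: oner_neq0.
Qed.

(** Condition (2) and injectivity are tested on point weightings; condition (1) rests on
    [G_not_cover]. *)
Lemma level_sets_iso (o : X) : (forall a, G a -> ~ a o) ->
  pseudoclopen_iso G (level_sets @` G) level_sets.
Proof.
move=> Go; split.
- by move=> _ [a _ <-]; exact: level_sets_pseudoclopen.
- split; [by move=> a Ga; exists a|move=> a b /set_mem Ga /set_mem Gb e|by []].
  have mem c z : G c -> (level_sets c).1 (point_element z) <-> c z.
    move=> Gc; rewrite /level_sets /= point_elementE //.
    by case: asboolP => // ncz; split => // /esym/eqP; rewrite oner_eq0.
  by apply/seteqP; split => z; rewrite -!mem // e.
move=> s t sG tG; rewrite cat_uniq => /and3P[_ /hasPn disj _]; split; last first.
  move=> /seteqP[e _]; rewrite -subset0 => z [sz tz].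
  apply: (e (point_element z)); split=> [a as_|[b bt] /=].
    by rewrite /= point_elementE; [rewrite asboolT //; exact: sz|exact: sG].
  by rewrite point_elementE; [rewrite asboolF // => bz; apply: tz; exists b|exact: tG].
move=> e; rewrite -subset0 => k [sk tk].
pose kf := set_val k : set X -> R.
have [k01 _ kn ka] : weighting kf := set_valP k.
have {}sk a : a \in s -> kf a <> 0 by move=> as_; exact: sk.
have {}tk b : b \in t -> kf b <> 1 by move=> bt kb; apply: tk; exists b.
(* With [s] empty, the base point [o] lies outside every member of [t]. *)
case es : s => [|a0 s0].
  have : (\bigcap_(a in [set` s]) a `\` \bigcup_(b in [set` t]) b) o; last by rewrite e.
  by split=> [a|[b bt bo]]; [rewrite es|exact: (Go b (tG b bt))].
have [||a as_ amin] := @seq_maximal _ (fun a b => b `<=` a /\ a <> b) a0 s0.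
- move=> x y w [yx xy] [wy yw]; split; first exact: subset_trans yx.
  by move=> e'; subst w; apply: xy; apply/seteqP; split.
- by move=> x [].
rewrite -es in as_ amin; have Ga := sG a as_.
(* Nonzero weights exclude disjoint members of [s], so the minimal [a] lies inside all of them. *)
have asub b : b \in s -> a `<=` b.
  move=> bs; case: (G_laminar Ga (sG b bs)) => // [ab0|ba].
    by case: (ka a b) => // [|/(sk a as_)|/(sk b bs)] //; split => //; exact: sG.
  have [<-//|ab] := pselect (a = b); by case: (amin b bs).
(* The members of [t] inside [a] are proper subsets, as [s] and [t] are disjoint. A point of [a]
   that they miss lies in the supposedly empty difference. *)
have [] := @G_not_cover a [seq c <- t | `[< c `<=` a >]] Ga.
  move=> c; rewrite mem_filter => /andP[/asboolP ca ct]; split => //; first exact: tG.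
  by move=> e'; have := disj c ct; rewrite /= e' as_.
move=> x ax; apply: contrapT => nx.
have : (\bigcap_(a in [set` s]) a `\` \bigcup_(b in [set` t]) b) x; last by rewrite e.
split=> [b bs|[b bt bx]]; first exact: (asub b bs).
have Gb := tG b bt; have ab : a <> b.
  by move=> e'; have := disj b bt; rewrite /= -e' as_.
case: (G_laminar Ga Gb) => [ab0|sab|ba].
- by have : (a `&` b) x by []; rewrite ab0.
- by case: (kn a b) => // [/(sk a as_)|/(tk b bt)].
- by apply: nx; exists b => //; rewrite mem_filter bt andbT; apply/asboolP.
Qed.

End TreeSpace.

(** * From the laminar family of cuts to the Boolean image *)

Lemma separating_set_card (X : Type) (a : set X) (x y : X) : x <> y ->
  ~ (a x <-> a y) -> (a `&` [set x; y] #= `I_1)%card.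
Proof.
move=> xy axy; have key u v : a u -> ~ a v -> (a `&` [set u; v] #= `I_1)%card.
  move=> au nav; have -> : a `&` [set u; v] = [set u].
    apply/seteqP; split => z; last by move=> ->; split; [|left].
    by case=> az [->//|/= zv]; case: nav; rewrite -zv.
  exact: card_set1.
have [ax|nax] := pselect (a x); first by apply: key => // ay; apply: axy.
rewrite setUC; apply: key => //; apply: contrapT => nay; apply: axy; split => //.
Qed.

Theorem corollary3p7 (L : topologicalType) (d : Order.disp_t)
    (Lstar : orderTopologicalType d)
    (L_compact : compact_space L) (L_zerodim : clopen_base L)
    (Lstar_compact : compact_space Lstar) (Lstar_zerodim : clopen_base Lstar)
    (L_image : continuous_image Lstar L) :
  exists K : topologicalType,
    [/\ compact_space K, connected [set: K] & boolean_image L K].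
Proof.
have [f cf sf] := L_image.
have cT : compact [set: Lstar] by case: Lstar_compact.
have [[o _] hL _] := L_compact.
(* This well-ordering ranks the jumps and is unrelated to the order of the line. *)
have [R R_wo] := well_ordering_principle Lstar.
pose bd (a : set L) := jumps (f @^-1` a).
have cpre a : clopen a -> clopen (f @^-1` a).
  by move=> ca; exact: preimage_clopen.
(* Surjectivity of [f] lets jumps upstairs determine a cut of [L] up to complement. *)
have pre_inj (a b : set L) : f @^-1` a = f @^-1` b -> a = b.
  by move=> e; apply/seteqP; split => y; have [x _ <-] := sf y I;
    rewrite -[a (f x)]/((f @^-1` a) x) e.
have bd_finite a : clopen a -> finite_set (bd a).
  by move=> /cpre; exact: clopen_finite_jumps.
have bdC a : bd (~` a) = bd a by rewrite /bd -preimage_setC jumpsC.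
have bdU a b : bd (a `&` b) `|` bd (a `|` b) `<=` bd a `|` bd b.
  by rewrite /bd preimage_setI preimage_setU; exact: jumpsIU_subU.
have bdI a b : bd (a `&` b) `&` bd (a `|` b) `<=` bd a `&` bd b.
  by rewrite /bd preimage_setI preimage_setU; exact: jumpsIU_subI.
have bd_inj a b : clopen a -> clopen b -> bd a = bd b -> a = b \/ a = ~` b.
  move=> /cpre ca /cpre cb /(clopen_jumps_inj cT ca cb)[/pre_inj e|e]; [by left|right].
  by apply: pre_inj; rewrite e preimage_setC.
have C_sep (x y : L) : x <> y -> exists2 c, clopen c & ~ (c x <-> c y).
  move=> /eqP xy; have := hL; rewrite open_hausdorff => /(_ x y xy).
  move=> [[U V] /= [/set_mem Ux /set_mem Vy] [oU _ /eqP UV]].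
  have [_ /(_ x U (open_nbhs_nbhs (conj oU Ux)))[c [cc cx] cU]] := L_zerodim.
  exists c => // h; have cy : c y by apply/h.
  have : (U `&` V) y by split => //; exact: cU.
  by rewrite UV.
have CC (a : set L) : clopen a -> clopen (~` a) by exact: (clopenC set0).
have CI (a b : set L) : clopen a -> clopen b -> clopen (a `&` b) by exact: clopenI.
pose G := tree (R := R) (C := @clopen L) (bd := bd) o.
have Glam a b : G a -> G b -> [\/ a `&` b = set0, a `<=` b | b `<=` a].
  exact: tree_laminar.
have Gcov a (s : seq (set L)) : G a ->
    (forall c, c \in s -> [/\ G c, c `<=` a & c <> a]) ->
    ~ (forall x, a x -> exists2 c, c \in s & c x).
  exact: tree_not_cover.
exists (set_type (weighting (R := Rdefinitions.R) (G := G))); split.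
- split; first by exists (point_element o).
  + by apply: hausdorff_set_type; apply: hausdorff_product => _; exact: norm_hausdorff.
  + by apply: compact_set_type; exact: weighting_compact.
- exact: weighting_connected.
pose phi := level_sets (R := Rdefinitions.R) (G := G).
exists G, (phi @` G), phi.
split; first exact: tree_sub.
- move=> x y xy.
  have [a Ga axy] := tree_separates R_wo CC bd_finite bdC bd_inj C_sep o xy.
  by exists a => //; exact: separating_set_card.
- by apply: (level_sets_iso Glam Gcov (o := o)) => a [].
Qed.
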